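(* Let $(M,d)$ be a separable metric space in which every closed bounded subset is compact. Let $(\Omega,\mathscr{F},\mathbb{P},\theta)$ be an ergodic measure-preserving dynamical system and let $\{f_\omega\}_{\omega\in\Omega}$ be a family of paracontraction maps $f_\omega\colon M\to M$ such that $(\omega,x)\mapsto f_\omega(x)$ is measurable. Let $\varphi(n,\omega,x)=f_{\theta^{n-1}(\omega)}\circ\cdots\circ f_\omega(x)$ be the induced random iteration of maps and let $$C_\varphi=\{x\in M\colon \mathbb{P}(\{\omega\in\Omega\colon f_\omega(x)=x\})=1\}.$$ Assume $C_\varphi\neq\emptyset$. Then for every $x\in M$, for $\mathbb{P}$-almost every $\omega$ the sequence $(\varphi(n,\omega,x))_{n\in\mathbb{N}}$ converges to some point of $C_\varphi$ (depending on $\omega$ and $x$).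
   Context: A continuous map $f\colon M\to M$ is a paracontraction if for every fixed point $x$ of $f$ and every $y$ that is not a fixed point of $f$, $d(f(y),x)<d(y,x)$ (and hence $d(f(y),x)\le d(y,x)$ for all $y$). An ergodic measure-preserving dynamical system $(\Omega,\mathscr{F},\mathbb{P},\theta)$ consists of a probability space and a measurable map $\theta\colon\Omega\to\Omega$ preserving $\mathbb{P}$ such that every $A\in\mathscr{F}$ with $\theta^{-1}(A)\subset A$ has $\mathbb{P}(A)\in\{0,1\}$. $M$ carries its Borel $\sigma$-algebra and $\Omega\times M$ the product $\sigma$-algebra. *)

(* Defs.v *)
From HB Require Import structures.
From mathcomp Require Import all_boot all_order all_algebra.
From mathcomp Require Import all_classical all_reals all_analysis.
Set Implicit Arguments. Unset Strict Implicit. Unset Printing Implicit Defensive.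
Import Order.TTheory GRing.Theory Num.Theory.
Local Open Scope classical_set_scope.
Local Open Scope ring_scope.

(* A metric space (with distance [mdist]) that is nonempty (pointed), so that
   its Borel sigma-algebra can be built with [g_sigma_algebraType]. *)
#[short(type="pointedMetricType")]
HB.structure Definition PointedMetric (K : numDomainType) :=
  { M of Metric K M & isPointed M }.

Section defs.
Context {R : realType} (M : pointedMetricType R).

Definition borel : Type := g_sigma_algebraType (@open M).

Definition mbounded (A : set M) : Prop :=
  exists (x0 : M) (r : R), forall y, A y -> mdist x0 y <= r.

Definition heine_borel_space : Prop :=
  forall A : set M, closed A -> mbounded A -> compact A.

Definition separable_space : Prop :=
  exists D : set M, countable D /\ dense D.

Definition paracontraction (f : M -> M) : Prop :=
  continuous f /\
  forall x y : M, f x = x -> f y <> y -> mdist (f y) x < mdist y x.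
End defs.

Section rds.
Context {d : measure_display} {Omega : measurableType d} {R : realType}.

Definition measure_preserving (P : probability Omega R) (theta : Omega -> Omega) :=
  measurable_fun setT theta /\
  forall A : set Omega, measurable A -> P (theta @^-1` A) = P A.

Definition ergodic (P : probability Omega R) (theta : Omega -> Omega) :=
  forall A : set Omega, measurable A -> theta @^-1` A `<=` A ->
    P A = 0%E \/ P A = 1%E.

Fixpoint rds_iter {M : Type} (theta : Omega -> Omega) (f : Omega -> M -> M)
  (n : nat) (w : Omega) (x : M) : M :=
  match n with
  | 0 => x
  | n'.+1 => f (iter n' theta w) (rds_iter theta f n' w x)
  end.

Definition C_phi {M : Type} (P : probability Omega R) (f : Omega -> M -> M) : set M :=
  [set x | P [set w | f w x = x] = 1%E].
End rds.

(* Main.v *)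
Require Import Defs.
From HB Require Import structures.
From mathcomp Require Import all_boot all_order all_algebra.
From mathcomp Require Import all_classical all_reals all_analysis.
From mathcomp Require Import lra.
Import Order.TTheory GRing.Theory Num.Theory.
Import numFieldNormedType.Exports.
Local Open Scope classical_set_scope.
Local Open Scope ring_scope.

(* Fix c0 in C.  If f_{theta^k w} fixes C for every k, then distances from an
   orbit to the points of C never increase, so it suffices that the orbit comes
   arbitrarily close to C.  By ergodicity, almost every w is such that each
   y outside C is moved by some f_{theta^n w}, hence brought closer to c0.  By
   compactness, on the set K_j of points at distance at most j+1 from c0 and at
   least 1/(j+1) from C, some m steps decrease the distance to c0 by at least
   1/(m+1) uniformly; so for some m this happens with positive probability,
   and by ergodicity at infinitely many times along almost every w.  An orbit
   staying in the interior of K_j would thus make its distance to c0 negative. *)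

(** * Continuity of distances, dense sequences, and monotone sequences of distances *)

Section metric_facts.
Context {R : realType}.

Lemma invSn_gt0 (n : nat) : 0 < n.+1%:R^-1 :> R.
Proof. by rewrite invr_gt0. Qed.

Lemma invSn_lt (e : R) : 0 < e -> exists n : nat, n.+1%:R^-1 < e.
Proof. by move=> /ltr_add_invr[n]; rewrite add0r; exists n. Qed.

Lemma invSn_le (m n : nat) : (m <= n)%N -> n.+1%:R^-1 <= m.+1%:R^-1 :> R.
Proof. by move=> mn; rewrite lef_pV2 ?posrE ?ltr0n// ler_nat. Qed.

Lemma continuous_mdist (T : topologicalType) (M : metricType R) (g h : T -> M) :
  continuous g -> continuous h -> continuous (fun y => mdist (g y) (h y) : R).
Proof.
move=> cg ch x; apply/cvgrPdist_lt => e e0.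
have e2 : 0 < e / 2 by rewrite divr_gt0.
have /metricType_numDomainType.cvgrPdist_lt/(_ _ e2) g2 := cg x.
have /metricType_numDomainType.cvgrPdist_lt/(_ _ e2) h2 := ch x.
near=> y.
have gy : mdist (g x) (g y) < e / 2 by near: y.
have hy : mdist (h x) (h y) < e / 2 by near: y.
have t1 := metric_triangle (g x) (g y) (h x).
have t2 := metric_triangle (g y) (h y) (h x).
have t3 := metric_triangle (g y) (g x) (h y).
have t4 := metric_triangle (g x) (h x) (h y).
rewrite (metric_sym (h y) (h x)) in t2; rewrite (metric_sym (g y) (g x)) in t3.
by rewrite ltr_norml; apply/andP; split; lra.
Unshelve. all: by end_near. Qed.

Lemma continuous_mdistr (M : metricType R) (g : M -> M) (c : M) :
  continuous g -> continuous (fun y => mdist (g y) c : R).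
Proof. by move=> cg; apply: continuous_mdist => // x; exact: cvg_cst. Qed.

Lemma open_mdist_lt (M : metricType R) (c : M) (r : R) :
  open [set y | mdist c y < r].
Proof.
under eq_set do rewrite metric_sym.
have /continuousP/(_ [set t | t < r]) := @continuous_mdistr M id c (fun x => cvg_id).
by apply; exact: open_lt.
Qed.

Lemma closed_mdist_le (M : metricType R) (c : M) (r : R) :
  closed [set y | mdist y c <= r].
Proof.
have /continuous_closedP/(_ [set t | t <= r]) := @continuous_mdistr M id c (fun x => cvg_id).
by apply; exact: closed_le.
Qed.

Lemma closed_mdist_ge (M : metricType R) (c : M) (r : R) :
  closed [set y | r <= mdist y c].
Proof.
have /continuous_closedP/(_ [set t | r <= t]) := @continuous_mdistr M id c (fun x => cvg_id).
by apply; exact: closed_ge.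
Qed.

(** If the bound failed at [y], the set [O] cut with the locus [h < r] would be open and nonempty,
    so it would contain some [e b]. This reduces uncountable conditions to countable, measurable
    ones. *)
Lemma dense_le_open (M : topologicalType) (e : nat -> M) (O : set M)
    (h : M -> R) (r : R) :
  dense (range e) -> open O -> continuous h ->
  (forall b, O (e b) -> r <= h (e b)) -> forall y, O y -> r <= h y.
Proof.
move=> de oO ch hr y Oy; rewrite leNgt; apply/negP => hy.
have [||z [[Oz hz] [b _ ebz]]] := de (O `&` h @^-1` [set t | t < r]).
- by exists y.
- by apply: openI => //; move/continuousP: ch; apply; exact: open_lt.
- by move: hz; rewrite /= -ebz ltNge hr// ebz.
Qed.

(** After more than [u 0 / delta] successive drops the sequence would be negative. *)
Lemma nonincreasing_no_recurrent_drop (u : nat -> R) (m : nat) (delta : R) :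
  0 < delta -> (forall n, 0 <= u n) -> (forall n, u n.+1 <= u n) ->
  ~ (forall N, exists2 n, (N <= n)%N & u (n + m)%N <= u n - delta).
Proof.
move=> d0 u0 /nonincreasing_seqP uS drop.
have desc k : exists n, u n <= u 0%N - k%:R * delta.
  elim: k => [|k [N uN]]; first by exists 0%N; rewrite mul0r subr0.
  have [n Nn un] := drop N; exists (n + m)%N.
  by rewrite -natr1; have := uS _ _ Nn; lra.
have := archi_boundP (divr_ge0 (u0 0%N) (ltW d0)).
set k := Num.Def.archi_bound _; rewrite ltr_pdivrMr// => uk.
by have [n un] := desc k; have := u0 n; lra.
Qed.

Lemma separable_enum (M : pointedMetricType R) : separable_space M ->
  exists e : nat -> M, dense (range e).
Proof.
move=> [D [/pcard_surjP[e De] dD]]; exists e => O O0 oO.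
have [x [Ox Dx]] := dD O O0 oO; exists x; split => //.
by have [n _ <-] := De _ Dx; exists n.
Qed.

Lemma dense_mdist (M : metricType R) (e : nat -> M) (y : M) (r : R) :
  dense (range e) -> 0 < r -> exists a, mdist y (e a) < r.
Proof.
move=> de r0; have [||z [/= zr [a _ eaz]]] := de [set z | mdist y z < r].
- by exists y; rewrite /= mdistxx.
- exact: open_mdist_lt.
- by exists a; rewrite eaz.
Qed.

(* Fejer monotonicity with respect to a closed set that the sequence approaches
   forces convergence, without assuming that the space is complete. *)
Lemma fejer_cvg (M : pointedMetricType R) (C : set M) (u : nat -> M) :
  heine_borel_space M -> closed C ->
  (forall c, C c -> forall n, mdist (u n.+1) c <= mdist (u n) c) ->
  (forall j : nat, exists2 c, C c & exists n, mdist (u n) c < j.+1%:R^-1) ->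
  exists2 c, C c & u @ \oo --> c.
Proof.
move=> hb cC fejer approach.
have mono c : C c -> forall m n, (m <= n)%N -> mdist (u n) c <= mdist (u m) c.
  by move=> Cc m n mn; have /nonincreasing_seqP := fejer c Cc; exact.
have {}approach j : exists c, C c /\ exists n, mdist (u n) c < j.+1%:R^-1.
  by have [c Cc un] := approach j; exists c.
have [c /all_and2[Cc uc]] := choice approach.
(* Each [c j] is within 1 of some term of [u], whose distance to [c0] is at most its initial value;
   hence this radius. *)
pose c0 := c 0%N; pose r := 1 + mdist (u 0%N) c0.
pose K := C `&` [set y | mdist y c0 <= r].
have cK : compact K.
  apply: hb.
    by apply: closedI => //; exact: closed_mdist_le.
  by exists c0, r => y [_ /=]; rewrite metric_sym.
have Kc j : K (c j).
  split => //=; have [n unc] := uc j.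
  have := metric_triangle (c j) (u n) c0; rewrite (metric_sym (c j) (u n)).
  have := mono _ (Cc 0%N) _ _ (leq0n n); have := invSn_le _ _ (leq0n j).
  by rewrite invr1 /r -/c0; move: unc; set q := _^-1; lra.
(* The limit is found as a cluster point of the nearby points [c j], not of [u] itself. *)
have [|x [[Cx _] clx]] := cK (c @ \oo) _.
  by exists 0%N => // j _; exact: Kc.
exists x => //; apply/metricType_numDomainType.cvgrPdist_lt => eps eps0.
have e2 : 0 < eps / 2 by rewrite divr_gt0.
have [J Jeps] := invSn_lt _ e2.
have [||z [[j /= Jj <-] xz]] := clx (c @` [set j | (J <= j)%N]) [set y | mdist x y < eps / 2].
- by exists J => // j /= Jj; exists j.
- by apply/metricType_numDomainType.nbhs_mdistP; exists (eps / 2).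
have [n unc] := uc j; exists n => // m /= nm.
(* Once within [eps / 2] of [c j], the sequence stays there. *)
have := mono _ (Cc j) _ _ nm; have := metric_triangle x (c j) (u m).
have {}unc := lt_trans unc (le_lt_trans (invSn_le _ _ Jj) Jeps).
by rewrite (metric_sym (c j) (u m)); move: xz => /=; lra.
Unshelve. all: by end_near. Qed.

End metric_facts.

(** * Almost sure statements along orbits and ergodic recurrence *)

Section measurable_dynamics.
Context {R : realType} {d : measure_display} {Omega : measurableType d}.

Lemma measurable_forall (Q : nat -> Prop) (B : nat -> set Omega) :
  (forall b, measurable (B b)) -> measurable [set w | forall b, Q b -> B b w].
Proof.
move=> mB; rewrite (_ : mkset _ = \bigcap_b [set w | Q b -> B b w]).
  apply: bigcapT_measurable => b; have [Qb|nQb] := pselect (Q b).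
    rewrite (_ : mkset _ = B b)//; apply/seteqP; split => w /=; first exact.
    by move=> Bw _.
  by rewrite (_ : mkset _ = setT)//; apply/seteqP; split => w //= _ /nQb.
by apply/seteqP; split => w h b; [move=> _ | ]; exact: h.
Qed.

Context (P : probability Omega R) (theta : Omega -> Omega).

Lemma measurable_iter (n : nat) :
  measurable_fun setT theta -> measurable_fun setT (fun w => iter n theta w).
Proof.
move=> mt; elim: n => [|n IH]; first exact: measurable_id.
exact: (measurableT_comp mt IH).
Qed.

Lemma measure_preserving_iter (n : nat) (A : set Omega) :
  measure_preserving P theta -> measurable A ->
  P [set w | A (iter n theta w)] = P A.
Proof.
move=> [mt pt] mA; elim: n => // n <-; rewrite -[RHS]pt.
  by congr (P _); apply/seteqP; split => w /=; rewrite -iterSr.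
by have := @measurable_iter n mt measurableT _ mA; rewrite setTI.
Qed.

Lemma ae_iter (Q : Omega -> Prop) : measure_preserving P theta ->
  {ae P, forall w, Q w} -> {ae P, forall w, forall n, Q (iter n theta w)}.
Proof.
move=> pt [N [mN N0 QN]]; apply: ae_foralln => n.
exists [set w | N (iter n theta w)]; split.
- by have := @measurable_iter n pt.1 measurableT _ mN; rewrite setTI.
- exact: etrans (measure_preserving_iter n _ pt mN) N0.
- by move=> w nQ; exact: QN.
Qed.

(** The set [W] of points visiting [A] contains [A] and its own preimage, so ergodicity gives it
    full measure. Almost every orbit stays in [W], and visiting [A] from time [N] on, for every [N],
    is recurrence. *)
Lemma ergodic_recurrence (A : set Omega) :
  measure_preserving P theta -> ergodic P theta -> measurable A -> P A <> 0%E ->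
  {ae P, forall w, forall N, exists2 n, (N <= n)%N & A (iter n theta w)}.
Proof.
move=> pt et mA PA.
pose W := \bigcup_n [set w | A (iter n theta w)].
have mW : measurable W.
  apply: bigcupT_measurable => n.
  by have := @measurable_iter n pt.1 measurableT _ mA; rewrite setTI.
have PW1 : P W = 1%E.
  have [|PW0|//] := et W mW.
    by move=> w [n _ /= An]; exists n.+1 => //=; rewrite -iterS iterSr.
  exfalso; apply: PA; apply: (subset_measure0 mA mW) => // w Aw.
  by exists 0%N.
have : {ae P, forall w, W w}.
  exists (~` W); split; [exact: measurableC| |by []].
  by rewrite probability_setC// PW1 subee.
move=> /(ae_iter _ pt); apply: filterS => w Ww N.
have [n _ /= An] := Ww N.
by exists (n + N)%N; [exact: leq_addl | rewrite iterD].
Qed.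

Lemma measurable_borel_closed (M : pointedMetricType R) (g : Omega -> borel M)
    (A : set M) : measurable_fun setT g -> closed A ->
  measurable [set w | A (g w)].
Proof.
move=> mg cA; rewrite -[X in measurable X]setTI; apply: mg => //.
rewrite -[A]setCK; apply: measurableC; apply: sub_sigma_algebra.
exact: closed_openC.
Qed.

End measurable_dynamics.

(** * Orbits of paracontractions along a fixed [w] *)

Section random_iteration.
Context {R : realType} {M : pointedMetricType R} {d : measure_display}
  {Omega : measurableType d} (P : probability Omega R)
  (theta : Omega -> Omega) (f : Omega -> M -> M).

Context (paraf : forall w, paracontraction (f w)).

Local Notation phi := (rds_iter theta f).

Lemma paracontraction_le (g : M -> M) (x y : M) :
  paracontraction g -> g x = x -> mdist (g y) x <= mdist y x.
Proof.
move=> [_ pg] gx; have [->//|/(pg _ _ gx)/ltW//] := pselect (g y = y).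
Qed.

Lemma rds_iterD (m n : nat) (w : Omega) (x : M) :
  phi (n + m) w x = phi m (iter n theta w) (phi n w x).
Proof.
elim: m => [|m IH]; first by rewrite addn0.
by rewrite addnS /= IH -iterD addnC.
Qed.

Lemma continuous_rds_iter (n : nat) (w : Omega) : continuous (phi n w).
Proof.
elim: n => [|n IH] x /=; first exact: cvg_id.
by apply: (@continuous_comp _ _ _ (phi n w)); [exact: IH | exact: (paraf _).1].
Qed.

Lemma continuous_rds_drop (n : nat) (w : Omega) (c : M) :
  continuous (fun y => mdist y c - mdist (phi n w y) c : R).
Proof.
move=> y; apply: cvgB.
  by apply: (@continuous_mdistr _ _ id) => x; exact: cvg_id.
by apply: continuous_mdistr; exact: continuous_rds_iter.
Qed.

Lemma rds_iter_le (w : Omega) (c y : M) (m n : nat) :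
  (forall k, f (iter k theta w) c = c) -> (m <= n)%N ->
  mdist (phi n w y) c <= mdist (phi m w y) c.
Proof.
move=> fc mn.
have /nonincreasing_seqP : forall k, mdist (phi k.+1 w y) c <= mdist (phi k w y) c.
  by move=> k; exact: paracontraction_le (paraf _) (fc k).
exact.
Qed.

(* The first map of the sequence that moves [y] brings it closer to [c]. *)
Lemma rds_iter_lt (w : Omega) (c y : M) :
  (forall k, f (iter k theta w) c = c) ->
  (exists n, f (iter n theta w) y <> y) ->
  exists L, mdist (phi L w y) c < mdist y c.
Proof.
move=> fc [n fny]; apply: contrapT => /forallNP noL.
have phiy k : phi k w y = y.
  elim: k => //= k IH; rewrite IH; apply: contrapT => fky.
  by apply: (noL k.+1); rewrite /= IH; exact: (paraf _).2 (fc k) fky.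
by have := phiy n.+1; rewrite /= phiy.
Qed.

(** A drop at [y] persists on a neighbourhood by continuity, and for all larger [m], since more
    steps only decrease the distance and the threshold shrinks. Compactness then yields a common
    [m]. *)
Lemma compact_uniform_drop (w : Omega) (c : M) (K : set M) : compact K ->
  (forall k, f (iter k theta w) c = c) ->
  (forall y, K y -> exists L, mdist (phi L w y) c < mdist y c) ->
  exists m : nat, forall y, K y ->
    m.+1%:R^-1 <= mdist y c - mdist (phi m w y) c.
Proof.
move=> /compact_near_coveringP cK fc drop.
pose Q (m : nat) y := m.+1%:R^-1 <= mdist y c - mdist (phi m w y) c.
have [|m _ /(_ m (leqnn m)) /= Qm] := cK nat \oo Q _; last by exists m.
move=> y /drop[L yL].
pose h z := mdist z c - mdist (phi L w z) c.
have ch : continuous h by exact: continuous_rds_drop.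
have [k hk] := invSn_lt (h y) ltac:(by rewrite subr_gt0).
have hO : nbhs y (h @^-1` [set t | k.+1%:R^-1 < t]).
  by apply: ch; apply: open_nbhs_nbhs; split => //; exact: open_gt.
(* [L] ensures enough steps, [k] a small enough threshold. *)
exists (h @^-1` [set t | k.+1%:R^-1 < t], [set m | (maxn L k <= m)%N]) => /=.
  by split => //; exists (maxn L k).
move=> [z m] [/= hz]; rewrite geq_max => /andP[Lm km]; rewrite /Q.
apply: (le_trans (invSn_le _ _ km)); apply: (le_trans (ltW hz)).
by rewrite /h lerB// rds_iter_le.
Qed.

(** * Measurability of the random iteration *)

Context (mf : measurable_fun [set: (Omega * borel M)%type]
    (fun p : (Omega * borel M)%type => (f p.1 p.2 : borel M))).

Lemma measurable_apply (g : Omega -> Omega) (h : Omega -> borel M) :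
  measurable_fun setT g -> measurable_fun setT h ->
  measurable_fun setT (fun w => f (g w) (h w) : borel M).
Proof.
by move=> mg mh; exact: (measurableT_comp mf (measurable_fun_pair mg mh)).
Qed.

Lemma measurable_rds_iter (n : nat) (x : M) : measurable_fun setT theta ->
  measurable_fun setT (fun w => phi n w x : borel M).
Proof.
move=> mt; elim: n => [|n IH] /=; first exact: measurable_cst.
exact: measurable_apply _ _ (measurable_iter theta n mt) IH.
Qed.

Lemma measurable_apply_cst (x : M) : measurable_fun setT (fun w => f w x : borel M).
Proof.
by apply: measurable_apply; [exact: measurable_id | exact: measurable_cst].
Qed.

Lemma measurable_fixed (x : M) : measurable [set w | f w x = x].
Proof.
apply: (measurable_borel_closed _ _ [set x]); first exact: measurable_apply_cst.
by apply: accessible_closed_set1; apply: hausdorff_accessible; exact: metric_hausdorff.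
Qed.

(** * Countable detection of motion and the structure of [C_phi] *)

Context (e : nat -> M).
Context (de : dense (range e)).

(* A countable family of events detecting motion: quantifying over the dense
   sequence makes them measurable, and [f w] moves [y] iff [w] lies in one of
   those attached to a ball around [y]. *)
Definition moved (i : nat * nat) : set Omega :=
  [set w | forall b, mdist (e i.1) (e b) < i.2.+1%:R^-1 ->
    i.2.+1%:R^-1 <= mdist (f w (e b)) (e b)].

Lemma measurable_moved i : measurable (moved i).
Proof.
apply: measurable_forall => b.
apply: (measurable_borel_closed _ _ [set y | _ <= mdist y (e b)]).
  exact: measurable_apply_cst.
exact: closed_mdist_ge.
Qed.

Lemma movedP (w : Omega) (y : M) : f w y <> y <->
  exists2 i, mdist (e i.1) y < i.2.+1%:R^-1 & moved i w.
Proof.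
have ch : continuous (fun z => mdist (f w z) z).
  by apply: continuous_mdist => [|x]; [exact: (paraf w).1 | exact: cvg_id].
split=> [/eqP fwy|[[a k] /= yk mw] fwy]; last first.
  have := @dense_le_open _ _ e _ _ _ de (@open_mdist_lt _ _ (e a) k.+1%:R^-1) ch mw _ yk.
  by rewrite fwy mdistxx leNgt invSn_gt0.
have hy : 0 < mdist (f w y) y by rewrite mdist_gt0.
have : nbhs y ((fun z => mdist (f w z) z) @^-1` [set t | mdist (f w y) y / 2 < t]).
  apply: ch; apply: open_nbhs_nbhs; split => /=; [exact: open_gt|lra].
move=> /metricType_numDomainType.nbhs_mdistP[r /= r0 hr].
(* Radius below [r / 2]: a ball of this radius containing [y] stays where the displacement exceeds
   half of that at [y]. *)
have [k] := invSn_lt (Num.min (r / 2) (mdist (f w y) y / 2))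
  ltac:(rewrite lt_min; lra).
rewrite lt_min => /andP[kr kh].
have [a yea] := @dense_mdist _ _ e y _ de (@invSn_gt0 R k).
exists (a, k); first by rewrite /= metric_sym.
move=> b /= ab; apply: ltW; apply: (lt_trans kh); apply: hr => /=.
apply: (le_lt_trans (metric_triangle _ (e a) _)).
have := lt_trans yea kr; have := lt_trans ab kr; lra.
Qed.

(** By [movedP], the event that [y] is moved is a countable union of events [moved i], so it is null
    iff each of them is. *)
Lemma C_phiP (y : M) : C_phi P f y <->
  forall i, mdist (e i.1) y < i.2.+1%:R^-1 -> P (moved i) = 0%E.
Proof.
have mfix := measurable_fixed y.
split=> [Cy i yi|y0].
  apply: (subset_measure0 (measurable_moved i) (measurableC mfix)).
    by move=> w mw; apply/movedP; exists i.
  by rewrite -[X in X = _]/(P (~` _)) probability_setC// Cy subee.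
have : P.-negligible (~` [set w | f w y = y]).
  pose F n := if @choice.unpickle (nat * nat)%type n is Some i then
    if mdist (e i.1) y < i.2.+1%:R^-1 then moved i else set0 else set0.
  apply: (@negligibleS _ _ _ _ (\bigcup_n F n)).
    move=> w /movedP[i yi mw]; exists (choice.pickle i) => //.
    by rewrite /F choice.pickleK yi.
  apply: negligible_bigcup => n; rewrite /F.
  case: choice.unpickle => [i|]; last exact: negligible_set0.
  case: ifPn => yi; last exact: negligible_set0.
  by apply/negligibleP; [exact: measurable_moved | exact: y0].
move=> /(measure_negligible (measurableC mfix)) P0.
rewrite /C_phi /= -[X in P X]setCK probability_setC; last exact: measurableC.
by rewrite [X in (1 - X)%E]P0 sube0.
Qed.

(** An event of positive probability that excludes [y] excludes every point of the ball attached to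
    it. *)
Lemma closed_C_phi : closed (C_phi P f).
Proof.
rewrite -openC openE => y /= /C_phiP/existsNP[i /not_implyP[yi Pi]].
have : nbhs y [set z | mdist (e i.1) z < i.2.+1%:R^-1].
  by apply: open_nbhs_nbhs; split => //; exact: open_mdist_lt.
by apply: filterS => z zi /C_phiP/(_ i zi).
Qed.

Lemma ae_countable (I : countType) (Q : I -> Omega -> Prop) :
  (forall i, {ae P, forall w, Q i w}) -> {ae P, forall w, forall i, Q i w}.
Proof.
move=> aeQ.
have : {ae P, forall w, forall n : nat,
    if choice.unpickle n is Some i then Q i w else True}.
  apply: ae_foralln => n; case: choice.unpickle => [i|]; first exact: aeQ.
  exact: aeW.
by apply: filterS => w Qw i; have := Qw (choice.pickle i); rewrite choice.pickleK.
Qed.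

(** [C_phi] may be uncountable; a single null set suffices because only the countably many null
    events [moved i] are discarded. *)
Lemma ae_fix_C_phi : {ae P, forall w, forall c, C_phi P f c -> f w c = c}.
Proof.
have : {ae P, forall w, forall i, P (moved i) = 0%E -> ~ moved i w}.
  apply: ae_countable => i; have [P0|Pi] := pselect (P (moved i) = 0%E).
    exists (moved i); split => //; first exact: measurable_moved.
    by move=> w /= /not_implyP[_ /contrapT].
  by apply: aeW => w /Pi.
apply: filterS => w nmw c /C_phiP Cc; apply: contrapT => /movedP[i ci mw].
exact: nmw (Cc i ci) mw.
Qed.

(** Each of the countably many non-null events [moved i] recurs almost surely, and every [y] outside
    [C_phi] lies in the ball of one of them. *)
Lemma ae_eventually_moved : measure_preserving P theta -> ergodic P theta ->
  {ae P, forall w, forall y, ~ C_phi P f y ->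
    exists n, f (iter n theta w) y <> y}.
Proof.
move=> pt et.
have : {ae P, forall w, forall i, P (moved i) <> 0%E ->
    exists n, moved i (iter n theta w)}.
  apply: ae_countable => i; have [P0|Pi] := pselect (P (moved i) = 0%E).
    by apply: aeW => w /(_ P0).
  have := ergodic_recurrence P theta _ pt et (measurable_moved i) Pi.
  by apply: filterS => w /(_ 0%N)[n _ nw] _; exists n.
apply: filterS => w mw y /C_phiP/existsNP[i /not_implyP[yi /mw[n miw]]].
by exists n; apply/movedP; exists i.
Qed.

(** * Recurrent uniform decrease away from [C_phi] *)

Definition far_from_C_phi (c0 : M) (j : nat) : set M :=
  [set y | mdist y c0 <= j.+1%:R /\
    forall c, C_phi P f c -> j.+1%:R^-1 <= mdist y c].

Lemma compact_far_from_C_phi (c0 : M) (j : nat) : heine_borel_space M ->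
  compact (far_from_C_phi c0 j).
Proof.
move=> hb; apply: hb; last first.
  by exists c0, j.+1%:R => y [+ _]; rewrite metric_sym.
rewrite (_ : far_from_C_phi c0 j = [set y | mdist y c0 <= j.+1%:R] `&`
    \bigcap_(c in C_phi P f) [set y | j.+1%:R^-1 <= mdist y c]).
  apply: closedI; first exact: closed_mdist_le.
  by apply: closed_bigI => c _; exact: closed_mdist_ge.
by apply/seteqP; split.
Qed.

(** Testing only dense points makes the event measurable. The index [m] gives both the number of
    steps and the size of the drop, so the events form a countable family. *)
Definition uniform_drop (c0 : M) (j m : nat) : set Omega :=
  [set w | forall b, far_from_C_phi c0 j (e b) ->
    mdist (phi m w (e b)) c0 <= mdist (e b) c0 - m.+1%:R^-1].

Lemma measurable_uniform_drop (c0 : M) (j m : nat) :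
  measurable_fun setT theta -> measurable (uniform_drop c0 j m).
Proof.
move=> mt; apply: measurable_forall => b.
apply: (measurable_borel_closed _ _ [set y | mdist y c0 <= _]).
  exact: measurable_rds_iter.
exact: closed_mdist_le.
Qed.

Lemma ae_uniform_drop_recurrent (c0 : M) (j : nat) : heine_borel_space M ->
  measure_preserving P theta -> ergodic P theta -> C_phi P f c0 ->
  {ae P, forall w, exists m, forall N, exists2 n, (N <= n)%N &
    uniform_drop c0 j m (iter n theta w)}.
Proof.
move=> hb pt et Cc0.
have ex : {ae P, forall w, exists m, uniform_drop c0 j m w}.
  have aefix := ae_iter P theta _ pt ae_fix_C_phi.
  have := ae_eventually_moved pt et.
  apply: filterS2 aefix => w fixw mvw.
  have fc0 k : f (iter k theta w) c0 = c0 by exact: fixw.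
  have [y [_ yC]|m Km] := @compact_uniform_drop w c0 _
      (compact_far_from_C_phi c0 j hb) fc0.
    (* A point of the far set is not in [C_phi], being at distance 0 from itself. *)
    apply: rds_iter_lt => //; apply: mvw => /yC.
    by rewrite mdistxx leNgt invSn_gt0.
  by exists m => b /Km; set q := _^-1; lra.
have [m Pm] : exists m, P (uniform_drop c0 j m) <> 0%E.
  apply: contrapT => /forallNP P0.
  have : {ae P, forall w, forall m, ~ uniform_drop c0 j m w}.
    apply: ae_foralln => m; exists (uniform_drop c0 j m); split.
    - exact: measurable_uniform_drop pt.1.
    - exact: contrapT (P0 m).
    - by move=> w /= /contrapT.
  move=> /(filterI ex) [N [mN N0 NN]].
  (* If all these events were null, the two almost sure statements would contradict each other at
     every [w]. *)
  have NT : N = setT.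
    apply/seteqP; split => // w _; apply: NN => -[[m mw] nmw]; exact: nmw mw.
  by move: N0; rewrite NT probability_setT => /eqP; rewrite onee_eq0.
have := ergodic_recurrence P theta _ pt et
  (measurable_uniform_drop c0 j m pt.1) Pm.
by apply: filterS => w; exists m.
Qed.

(** Density transfers the bound only within an open set, hence the interior. *)
Lemma uniform_drop_interior (c0 : M) (j m : nat) (w : Omega) (y : M) :
  uniform_drop c0 j m w -> (far_from_C_phi c0 j)° y ->
  mdist (phi m w y) c0 <= mdist y c0 - m.+1%:R^-1.
Proof.
move=> dropw yj.
have : m.+1%:R^-1 <= mdist y c0 - mdist (phi m w y) c0.
  apply: (@dense_le_open _ _ e _ (fun z => mdist z c0 - mdist (phi m w z) c0) _
    de (@open_interior _ (far_from_C_phi c0 j))) => //.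
  - exact: continuous_rds_drop.
  - by move=> b /interior_subset /dropw; set q := _^-1; lra.
by set q := _^-1; lra.
Qed.

Lemma interior_far_from_C_phi (c0 : M) (j k : nat) (y : M) : (j < k)%N ->
  mdist y c0 <= j.+1%:R -> (forall c, C_phi P f c -> j.+1%:R^-1 <= mdist y c) ->
  (far_from_C_phi c0 k)° y.
Proof.
(* The gaps between levels [j] and [k] in the two defining bounds. *)
move=> jk yj yC; pose r : R := Num.min (k.+1%:R - j.+1%:R) (j.+1%:R^-1 - k.+1%:R^-1).
have r0 : 0 < r.
  by rewrite lt_min !subr_gt0 ltr_nat ltnS jk ltf_pV2 ?posrE ?ltr0n// ltr_nat ltnS.
apply/metricType_numDomainType.nbhs_mdistP; exists r => //= z /=.
rewrite /r lt_min => /andP[yz1 yz2]; split.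
  have := metric_triangle z y c0; rewrite (metric_sym z y).
  move: yz1 yj; set a := j.+1%:R; set b := k.+1%:R; lra.
move=> c /yC; have := metric_triangle y z c.
move: yz2; set a := j.+1%:R^-1; set b := k.+1%:R^-1; lra.
Qed.

End random_iteration.

(** * Almost sure convergence of the orbits *)

Theorem theoremB (R : realType) (M : pointedMetricType R)
  (d : measure_display) (Omega : measurableType d)
  (P : probability Omega R) (theta : Omega -> Omega)
  (f : Omega -> M -> M) :
  separable_space M ->
  heine_borel_space M ->
  measure_preserving P theta ->
  ergodic P theta ->
  (forall w, paracontraction (f w)) ->
  measurable_fun [set: (Omega * borel M)%type]
    (fun p : (Omega * borel M)%type => (f p.1 p.2 : borel M)) ->
  C_phi P f !=set0 ->
  forall x : M, {ae P, forall w, exists2 c : M, C_phi P f c &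
    (fun n => rds_iter theta f n w x) @ \oo --> c}.
Proof.
move=> /separable_enum[e de] hb pt et paraf mf [c0 Cc0] x.
have aefix := ae_iter P theta _ pt (ae_fix_C_phi P f paraf mf e de).
(* The level used below depends on [w], so one null set must serve all levels. *)
have : {ae P, forall w, forall j, exists m, forall N, exists2 n, (N <= n)%N &
    uniform_drop P theta f e c0 j m (iter n theta w)}.
  by apply: ae_foralln => j; exact: ae_uniform_drop_recurrent.
apply: filterS2 aefix => w fixw dropw.
have fixc c : C_phi P f c -> forall k, f (iter k theta w) c = c.
  by move=> Cc k; exact: fixw.
apply: fejer_cvg => //; first exact: (closed_C_phi P f paraf mf e de).
  by move=> c Cc n; apply: rds_iter_le => //; exact: fixc.
move=> j; apply: contrapT => nj.
have far n c : C_phi P f c -> j.+1%:R^-1 <= mdist (rds_iter theta f n w x) c.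
  by move=> Cc; rewrite leNgt; apply/negP => nc; apply: nj; exists c => //; exists n.
(* Large enough for both bounds of level [k] to hold along the whole orbit. *)
pose k := maxn j (Num.Def.archi_bound (mdist x c0)).
have xk : mdist x c0 <= k.+1%:R.
  apply: (le_trans (ltW (archi_boundP (mdist_ge0 _ _)))).
  by rewrite ler_nat leqW// leq_maxr.
(* One level higher, so that the orbit lies in the interior of the far set. *)
have [m drop] := dropw k.+1.
apply: (@nonincreasing_no_recurrent_drop _
    (fun n => mdist (rds_iter theta f n w x) c0) m m.+1%:R^-1).
- exact: invSn_gt0.
- by move=> n; exact: mdist_ge0.
- by move=> n; apply: rds_iter_le => //; exact: fixc.
move=> N; have [n Nn dn] := drop N; exists n => //.
rewrite rds_iterD; apply: uniform_drop_interior dn _ => //.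
apply: (@interior_far_from_C_phi _ _ _ _ _ _ c0 k) => //.
  apply: le_trans xk; apply: (@rds_iter_le _ _ _ _ theta f paraf w c0 x 0) => //.
  exact: fixc.
move=> c Cc; apply: le_trans (far n c Cc).
by apply: invSn_le; exact: leq_maxl.
Qed.
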